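(* Assume every vertex of $T$ has at least two successors and that $\nu$ is a doubling measure on $(\partial T,\rho)$. Let $b\in L^1_{\mathrm{loc}}(\partial T,\nu)$. The following are equivalent: (i) $b\in BMO$; (ii) there is a function $f:[0,\infty)\times(0,\infty)\to[0,\infty)$ (depending on $b$), nondecreasing in its first variable, such that for every operator $\mathcal K\in\mathcal O$, with kernel $K$ having constants $C_K$ and $\alpha$ as in conditions (A2) and (A3), the measure $\sigma=|\mathcal Kb|\,m_\nu$ on $T$ satisfies $$\sigma(T_v)=\sum_{x\in T_v}|\mathcal Kb(x)|\,m_\nu(x)\le f(C_K,\alpha)\,m_\nu(v)\qquad\forall v\in T,$$ where $\mathcal Kb(x)=\int_{\partial T}K(x,\omega)b(\omega)\,d\nu(\omega)$.
   Context: Let $T$ be a tree, identified with its vertex set, with graph distance $d$; $x\sim y$ means $d(x,y)=1$. Let $\Omega$ be the boundary (space of ends) of $T$; fix $\omega_*\in\Omega$ and set $\partial T=\Omega\setminus\{\omega_*\}$. For $x\in T$, $[x,\omega_* )$ is the geodesic ray from $x$ to $\omega_*$; for $\omega\in\partial T$, $(\omega,\omega_* )$ is the doubly infinite geodesic joining $\omega$ and $\omega_*$. For $y\in T$ write $x\le y$ if either $x\in T$ and $y\in[x,\omega_* )$, or $x\in\partial T$ and $y\in(x,\omega_* )$. Fix $o\in T$ and let $(x_j)_{j\ge0}$ enumerate $[o,\omega_* )$ with $x_0=o$, $x_j\sim x_{j+1}$; the level is $\ell(x)=\lim_{j\to\infty}(j-d(x,x_j))$. Successors: $s(x)=\{y\sim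 x:\ell(y)=\ell(x)-1\}$. The confluent $\eta\wedge\zeta$ of $\eta,\zeta\in T\cup\partial T$ is the vertex of minimal level among $x\in T$ with $\eta\le x$, $\zeta\le x$. Sectors: $T_x=\{y\in T:y\le x\}$, $\partial T_x=\{\omega\in\partial T:\omega\le x\}$. Gromov distance: $\rho(\eta,\xi)=e^{\ell(\eta\wedge\xi)}$ for $\eta\ne\xi$, $\rho(\eta,\eta)=0$; its balls are the sets $\partial T_x$. $\nu$ is a positive Borel measure on $\partial T$ with $0<\nu(\partial T_x)<\infty$; doubling means $\nu(B_\rho(\omega,2r))\le C\nu(B_\rho(\omega,r))$ for all $\omega,r$. $m_\nu(x)=\nu(\partial T_x)$. $L^1_{\mathrm{loc}}$ means integrable on each $\partial T_x$. For $E\subset\partial T$, $b_E=\frac{1}{\nu(E)}\int_Eb\,d\nu$; $BMO$ is the space of $b\in L^1_{\mathrm{loc}}(\partial T,\nu)$ with $\|b\|_{BMO}=\sup_{x\in T}\frac{1}{\nu(\partial T_x)}\int_{\partial T_x}|b-b_{\partial T_x}|\,d\nu<\infty$. The class $\mathcal O$ consists of integral operators $\mathcal Kg(x)=\int_{\partial T}K(x,\omega)g(\omega)\,d\nu(\omega)$ whose kernel $K:T\times\partial T\to\mathbb C$ satisfies: (A1) for every $x_0\in T$, $\omega\mapsto K(x_0,\omega)$ is $\nu$-integrable and $\int_{\partial T}K(x_0,\omega)\,d\nu(\omega)=0$; (A2) $C_K:=\operatorname{ess\,sup}_{\omega\in\partial T}\sum_{x\in T}|K(x,\omega)|m_\nu(x)<\infty$;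 (A3) there is $\alpha>0$ with $|K(x,\omega)|\le m_\nu(x)^\alpha/m_\nu(x\wedge\omega)^{\alpha+1}$ for all $x\in T$, $\omega\in\partial T$. *)

(* Defs.v *)
From HB Require Import structures.
From mathcomp Require Import all_boot all_order all_algebra.
From mathcomp Require Import all_classical all_reals all_analysis.
From mathcomp Require Import complex ess_sup_inf.
From Stdlib Require Import ClassicalEpsilon.
Set Implicit Arguments.
Unset Strict Implicit.
Unset Printing Implicit Defensive.
Import Order.TTheory GRing.Theory Num.Theory.
Import numFieldNormedType.Exports.
Local Open Scope classical_set_scope.
Local Open Scope ring_scope.

(* The vertex set is V; p x is the neighbour of x on the geodesic ray  *)
(* [x, omega_star) (the "predecessor" of x).  The graph with edges        *)
(* {x, p x} is a tree iff p has no cycles and any two rays merge;      *)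
(* omega_star is then the common end of all rays [x, omega_star) = {p^n x}.  *)
Definition tree_with_end {V : Type} (p : V -> V) : Prop :=
  (forall (x : V) (n : nat), iter n.+1 p x <> x) /\
  (forall x y : V, exists m n : nat, iter m p x = iter n p y).

(* lev is the level function l(x) relative to the base point o:
   l(o) = 0 and l(p x) = l(x) + 1 (this determines l uniquely). *)
Definition level_fn {V : Type} (p : V -> V) (o : V) (lev : V -> int) : Prop :=
  lev o = 0 /\ forall x, lev (p x) = lev x + 1.

Definition succs {V : Type} (p : V -> V) (x : V) : set V := [set y | p y = x].

Definition at_least_two_succs {V : Type} (p : V -> V) : Prop :=
  forall x, exists y1 y2, [/\ y1 <> y2, y1 \in succs p x & y2 \in succs p x].

Definition vle {V : Type} (p : V -> V) (x y : V) : Prop := exists n, iter n p x = y.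

Definition sector {V : Type} (p : V -> V) (x : V) : set V := [set y | vle p y x].

(* A point omega of dT = Omega \ {omega_star} is encoded by the line
   (omega, omega_star), listed downwards: g n is the vertex of level -n. *)
Definition desc_line {V : Type} (p : V -> V) (lev : V -> int) (g : nat -> V) :=
  lev (g 0%N) = 0 /\ forall n, p (g n.+1) = g n.

Definition is_boundary {V Bd : Type} (p : V -> V) (lev : V -> int)
  (emb : Bd -> nat -> V) : Prop :=
  [/\ forall w, desc_line p lev (emb w), injective emb &
      forall g, desc_line p lev g -> exists w, emb w = g].

(* omega <= x : x lies on (omega, omega_star) *)
Definition ble {V Bd : Type} (p : V -> V) (emb : Bd -> nat -> V) (w : Bd) (x : V) :=
  exists n m, iter m p (emb w n) = x.

Definition bsector {V Bd : Type} (p : V -> V) (emb : Bd -> nat -> V) (x : V) : set Bd :=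
  [set w | ble p emb w x].

Definition confluent_of {V : Type} (o : V) (lev : V -> int) (U : V -> Prop) : V :=
  epsilon (inhabits o) (fun c => U c /\ forall y, U y -> (lev c <= lev y)%R).

Definition conf_vb {V Bd : Type} (p : V -> V) (o : V) (lev : V -> int)
  (emb : Bd -> nat -> V) (x : V) (w : Bd) : V :=
  confluent_of o lev (fun y => vle p x y /\ ble p emb w y).

Definition conf_bb {V Bd : Type} (p : V -> V) (o : V) (lev : V -> int)
  (emb : Bd -> nat -> V) (w1 w2 : Bd) : V :=
  confluent_of o lev (fun y => ble p emb w1 y /\ ble p emb w2 y).

Definition gromov {R : realType} {V Bd : Type} (p : V -> V) (o : V)
  (lev : V -> int) (emb : Bd -> nat -> V) (w1 w2 : Bd) : R :=
  if `[< w1 = w2 >] then 0 else expR ((lev (conf_bb p o lev emb w1 w2))%:~R).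

Definition rho_ball {R : realType} {V Bd : Type} (p : V -> V) (o : V)
  (lev : V -> int) (emb : Bd -> nat -> V) (w : Bd) (r : R) : set Bd :=
  [set w' | gromov p o lev emb w w' < r].

Definition doubling {R : realType} {V : Type} {d} {Bd : measurableType d}
  (p : V -> V) (o : V) (lev : V -> int) (emb : Bd -> nat -> V)
  (nu : {measure set Bd -> \bar R}) : Prop :=
  exists C : R, forall (w : Bd) (r : R),
    (nu (rho_ball p o lev emb w (2 * r)) <= C%:E * nu (rho_ball p o lev emb w r))%E.

Definition mnu {R : realType} {V : Type} {d} {Bd : measurableType d}
  (p : V -> V) (emb : Bd -> nat -> V) (nu : {measure set Bd -> \bar R}) (x : V) : R :=
  fine (nu (bsector p emb x)).

Definition cintegrable {R : realType} {d} {Bd : measurableType d}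
  (nu : {measure set Bd -> \bar R}) (A : set Bd) (f : Bd -> R[i]) : Prop :=
  nu.-integrable A (fun w => (complex.Re (f w))%:E) /\ nu.-integrable A (fun w => (complex.Im (f w))%:E).

Definition cintegral {R : realType} {d} {Bd : measurableType d}
  (nu : {measure set Bd -> \bar R}) (A : set Bd) (f : Bd -> R[i]) : R[i] :=
  Complex (Rintegral nu A (fun w => complex.Re (f w))) (Rintegral nu A (fun w => complex.Im (f w))).

Definition L1loc {R : realType} {V : Type} {d} {Bd : measurableType d}
  (p : V -> V) (emb : Bd -> nat -> V) (nu : {measure set Bd -> \bar R})
  (b : Bd -> R[i]) : Prop :=
  forall x : V, cintegrable nu (bsector p emb x) b.

Definition bavg {R : realType} {V : Type} {d} {Bd : measurableType d}
  (p : V -> V) (emb : Bd -> nat -> V) (nu : {measure set Bd -> \bar R})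
  (b : Bd -> R[i]) (x : V) : R[i] :=
  Complex ((mnu p emb nu x)^-1) 0 * cintegral nu (bsector p emb x) b.

Definition BMO {R : realType} {V : Type} {d} {Bd : measurableType d}
  (p : V -> V) (emb : Bd -> nat -> V) (nu : {measure set Bd -> \bar R})
  (b : Bd -> R[i]) : Prop :=
  L1loc p emb nu b /\
  exists M : R, forall x : V,
    (mnu p emb nu x)^-1 *
      Rintegral nu (bsector p emb x) (fun w => Normc.normc (b w - bavg p emb nu b x))
    <= M.

Definition kerA1 {R : realType} {V : Type} {d} {Bd : measurableType d}
  (nu : {measure set Bd -> \bar R}) (K : V -> Bd -> R[i]) : Prop :=
  forall x0 : V, cintegrable nu setT (K x0) /\ cintegral nu setT (K x0) = 0.

Definition kerSum {R : realType} {V : choiceType} {d} {Bd : measurableType d}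
  (p : V -> V) (emb : Bd -> nat -> V) (nu : {measure set Bd -> \bar R})
  (K : V -> Bd -> R[i]) (w : Bd) : \bar R :=
  \esum_(x in [set: V]) (Normc.normc (K x w) * mnu p emb nu x)%:E.

Definition CKe {R : realType} {V : choiceType} {d} {Bd : measurableType d}
  (p : V -> V) (emb : Bd -> nat -> V) (nu : {measure set Bd -> \bar R})
  (K : V -> Bd -> R[i]) : \bar R :=
  ess_sup nu (kerSum p emb nu K).

Definition kerA2 {R : realType} {V : choiceType} {d} {Bd : measurableType d}
  (p : V -> V) (emb : Bd -> nat -> V) (nu : {measure set Bd -> \bar R})
  (K : V -> Bd -> R[i]) : Prop :=
  (CKe p emb nu K < +oo)%E.

Definition kerA3 {R : realType} {V : Type} {d} {Bd : measurableType d}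
  (p : V -> V) (o : V) (lev : V -> int) (emb : Bd -> nat -> V)
  (nu : {measure set Bd -> \bar R}) (alpha : R) (K : V -> Bd -> R[i]) : Prop :=
  forall (x : V) (w : Bd),
    Normc.normc (K x w) <=
      mnu p emb nu x `^ alpha / mnu p emb nu (conf_vb p o lev emb x w) `^ (alpha + 1).

Definition Kapply {R : realType} {V : Type} {d} {Bd : measurableType d}
  (nu : {measure set Bd -> \bar R}) (K : V -> Bd -> R[i]) (b : Bd -> R[i]) (x : V) : R[i] :=
  cintegral nu setT (fun w => K x w * b w).

Definition cond_ii {R : realType} {V : choiceType} {d} {Bd : measurableType d}
  (p : V -> V) (o : V) (lev : V -> int) (emb : Bd -> nat -> V)
  (nu : {measure set Bd -> \bar R}) (b : Bd -> R[i]) : Prop :=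
  exists f : R -> R -> R,
    [/\ (forall c a, 0 <= c -> 0 < a -> 0 <= f c a),
        (forall c c' a, 0 <= c -> c <= c' -> 0 < a -> f c a <= f c' a) &
        forall (K : V -> Bd -> R[i]) (alpha : R),
          0 < alpha -> kerA1 nu K -> kerA2 p emb nu K -> kerA3 p o lev emb nu alpha K ->
          (forall x, cintegrable nu setT (fun w => K x w * b w)) /\
          forall v : V,
            (\esum_(x in sector p v)
                (Normc.normc (Kapply nu K b x) * mnu p emb nu x)%:E
             <= (f (fine (CKe p emb nu K)) alpha * mnu p emb nu v)%:E)%E].

(* Main.v *)
(* BMO implies the Carleson bound: for x below v, replace b by b - b_v, which
   (A1) allows.  On the sector of v, the sum over x of |K(x, w)| m(x) is at
   most C_K by (A2).  Off the sector, cut the boundary into the rings between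
   the successive ancestors p^j v: doubling and the branching of the tree give
   m(x) <= q m(p x) with q < 1 and make b_{p^j v} drift from b_v at most
   linearly in j, so (A3) bounds the j-th ring by a multiple of
   j q^(alpha j), and what remains is the sum of m(x)^(1 + alpha) over the
   sector of v, geometric in the depth of x.
   Conversely, apply the Carleson bound to kernels living at the single vertex
   v, K(v, w) = phi(w) / m(v) with phi supported in the sector of v, of mean
   zero and bounded by 1; these satisfy (A2) with C_K <= 1 and (A3) with
   alpha = 1, and phi can be chosen to detect the mean oscillation of b. *)
Require Import Defs.
From HB Require Import structures.
From mathcomp Require Import all_boot all_order all_algebra.
From mathcomp Require Import all_classical all_reals all_analysis.
From mathcomp Require Import complex ess_sup_inf.
From mathcomp Require Import measurable_realfun zify ring lra.
From Stdlib Require Import ClassicalEpsilon.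
Import Order.TTheory GRing.Theory Num.Theory.
Import numFieldNormedType.Exports.
Local Open Scope classical_set_scope.
Local Open Scope ring_scope.

Set Implicit Arguments.
Unset Strict Implicit.
Unset Printing Implicit Defensive.

Local Notation normc := Normc.normc.

(** * Rays, boundary lines and confluents in the tree *)

Section Tree.
Context {V : Type} {Bd : Type} (p : V -> V) (o : V) (lev : V -> int)
  (emb : Bd -> nat -> V).
Context (tree : tree_with_end p).
Context (levP : level_fn p o lev).
Context (bdP : is_boundary p lev emb).

Lemma lev_iter n x : lev (iter n p x) = lev x + n%:Z.
Proof.
elim: n => [|n IH] /=; first by rewrite addr0.
by rewrite (proj2 levP) IH; lia.
Qed.

Lemma emb_iter w n m : iter m p (emb w (m + n)%N) = emb w n.
Proof.
have [lineP _ _] := bdP; elim: m => [//|m IH].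
by rewrite iterSr addSn (proj2 (lineP w)).
Qed.

Lemma vle_refl x : vle p x x. Proof. by exists 0%N. Qed.

Lemma vle_trans x y z : vle p x y -> vle p y z -> vle p x z.
Proof. by move=> [m <-] [n <-]; exists (n + m)%N; rewrite iterD. Qed.

Lemma vle_lev_le x y : vle p x y -> lev x <= lev y.
Proof. by move=> [n <-]; rewrite lev_iter; lia. Qed.

Lemma vle_total x y z : vle p x y -> vle p x z -> lev y <= lev z -> vle p y z.
Proof.
move=> [m <-] [n <-]; rewrite !lev_iter => le.
by exists (n - m)%N; rewrite -iterD subnK//; lia.
Qed.

Lemma vle_lev_eq x y : vle p x y -> lev x = lev y -> x = y.
Proof.
move=> [n <-]; rewrite lev_iter => e.
by have -> : n = 0%N by lia.
Qed.

Lemma ble_vle w x y : ble p emb w x -> vle p x y -> ble p emb w y.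
Proof. by move=> [n [m <-]] [k <-]; exists n, (k + m)%N; rewrite iterD. Qed.

Lemma bsectorS x y : vle p x y -> bsector p emb x `<=` bsector p emb y.
Proof. by move=> xy w wx; exact: ble_vle wx xy. Qed.

(** Going down the line of [w] past both indices reaches a vertex below [x] and [y]. Comparisons
    along a doubly infinite line thus reduce to comparisons along one ray. *)
Lemma ble_below w x y : ble p emb w x -> ble p emb w y ->
  exists2 z, vle p z x & vle p z y.
Proof.
move=> [n [m <-]] [n' [m' <-]]; exists (emb w (maxn n n')).
  exists (m + (maxn n n' - n))%N; rewrite iterD -{2}(subnK (leq_maxl n n')).
  by rewrite emb_iter.
exists (m' + (maxn n n' - n'))%N; rewrite iterD -{2}(subnK (leq_maxr n n')).
by rewrite emb_iter.
Qed.

Lemma ble_total w x y :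
  ble p emb w x -> ble p emb w y -> lev x <= lev y -> vle p x y.
Proof.
by move=> wx wy; have [z zx zy] := ble_below wx wy; exact: vle_total zx zy.
Qed.

Lemma ble_lev_eq w x y :
  ble p emb w x -> ble p emb w y -> lev x = lev y -> x = y.
Proof.
by move=> wx wy e; apply: (vle_lev_eq _ e); apply: ble_total wx wy _; rewrite e.
Qed.

(** The ray from [x] merges with the ray from [emb w 0], which is part of the line of [w]. *)
Lemma ble_ray w x : exists n, ble p emb w (iter n p x).
Proof.
have [m [n e]] := proj2 tree (emb w 0%N) x.
by exists n; rewrite -e; exists 0%N, m.
Qed.

(* On the ray from x, membership in U is decided by the level, so a point of
   minimal level exists and epsilon picks it. *)
Lemma confluent_ofP x0 x (U : V -> Prop) :
  U x0 -> (forall y, U y -> vle p x y) ->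
  let c := confluent_of o lev U in U c /\ forall y, U y -> lev c <= lev y.
Proof.
move=> Ux0 Uray; apply: (epsilon_spec (inhabits o)
  (fun c => U c /\ forall y, U y -> lev c <= lev y)).
have [n en] := Uray _ Ux0.
have exU : exists n, `[< U (iter n p x) >].
  by exists n; rewrite en; apply/asboolP.
exists (iter (ex_minn exU) p x); case: ex_minnP => m /asboolP Um mmin.
split=> // y Uy; have [k ek] := Uray _ Uy.
have /mmin : `[< U (iter k p x) >] by rewrite ek; apply/asboolP.
by rewrite -ek !lev_iter; lia.
Qed.

Lemma conf_vbP x w : let c := conf_vb p o lev emb x w in
  [/\ vle p x c, ble p emb w c &
      forall y, vle p x y -> ble p emb w y -> lev c <= lev y].
Proof.
have [n wn] := ble_ray w x.
have [|y [] //|[xc wc] cmin] := @confluent_ofP (iter n p x) x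
  (fun y => vle p x y /\ ble p emb w y).
  by split=> //; exists n.
by split=> // y xy wy; apply: cmin.
Qed.

Lemma conf_vb_in x w : ble p emb w x -> conf_vb p o lev emb x w = x.
Proof.
move=> wx; have [xc wc /(_ x (vle_refl x) wx) cx] := conf_vbP x w.
by apply/esym/vle_lev_eq => //; apply/le_anti; rewrite cx vle_lev_le.
Qed.

(** Distinct lines differ at some index [n], and every common vertex lies above [emb w n]. This puts
    the common vertices on one ray, as [confluent_ofP] requires. *)
Lemma conf_bbP w w' x : w <> w' -> ble p emb w x -> ble p emb w' x ->
  let c := conf_bb p o lev emb w w' in
  [/\ ble p emb w c, ble p emb w' c &
      forall y, ble p emb w y -> ble p emb w' y -> lev c <= lev y].
Proof.
move=> ww' wx w'x.
have [lineP injemb _] := bdP.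
have [n ne] : exists n, emb w n <> emb w' n.
  apply: contrapT => /forallNP e; apply: ww'; apply: injemb.
  by apply/funext => n; apply: contrapT; exact: e.
have lineE v m : lev (emb v m) = - m%:Z.
  have := emb_iter v 0%N m; rewrite addn0 => /(congr1 lev).
  by rewrite lev_iter (proj1 (lineP v)); lia.
(* If a common vertex were at or below the level of [emb w n], both lines would pass through its
   ancestor at that level, against the choice of [n]. *)
have above y : ble p emb w y -> ble p emb w' y -> lev (emb w n) < lev y.
  move=> wy w'y; rewrite ltNge; apply/negP => le.
  have bw v : ble p emb v (emb v n) by exists n, 0%N.
  apply: ne; apply: (@ble_lev_eq w); rewrite ?lineE//.
  apply: ble_vle wy _; apply: ble_total w'y (bw w') _.
  by rewrite lineE -(lineE w).
have [||[? ?] cmin] := @confluent_ofP x (emb w n)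
  (fun y => ble p emb w y /\ ble p emb w' y).
- by [].
- move=> y [wy w'y]; apply: (@ble_total w) => //; first by exists n, 0%N.
  exact/ltW/above.
by split=> // y wy w'y; apply: cmin.
Qed.

Section Balls.
Context {R : realType}.

(** Nonzero Gromov distances are integer powers of e, so all radii between two consecutive powers
    give the same ball. Balls are open, hence the upper end of the window is included. *)
Lemma rho_ballE w x (r : R) : ble p emb w x ->
  expR (lev x)%:~R < r -> r <= expR (lev x + 1)%:~R ->
  rho_ball p o lev emb w r = bsector p emb x.
Proof.
move=> wx xr rx; apply/seteqP; split => w' /=; rewrite /rho_ball /gromov /=.
  case: asboolP => [<- //|ww' lt].
  have [y wy w'y] : exists2 y, ble p emb w y & ble p emb w' y.
    have [n w'n] := ble_ray w' x.
    by exists (iter n p x) => //; apply: ble_vle wx _; exists n.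
  have [wc w'c _] := conf_bbP ww' wy w'y.
  apply: ble_vle w'c _; apply: ble_total wc wx _.
  by move: (lt_le_trans lt rx); rewrite ltr_expR ltr_int; lia.
move=> w'x; case: asboolP => [_|ww'].
  exact: lt_trans (expR_gt0 _) xr.
have [_ _ /(_ x wx w'x) cx] := conf_bbP ww' wx w'x.
by apply: le_lt_trans xr; rewrite ler_expR ler_int.
Qed.

End Balls.
End Tree.

(** * Geometric sums, plain and with an affine weight *)

Section GeometricSums.
Context {R : realType} (r : R) (r0 : 0 <= r) (r1 : r < 1).

Lemma sum_exprn_le n : \sum_(i < n) r ^+ i <= (1 - r)^-1.
Proof.
have r1' : 0 < 1 - r by rewrite subr_gt0.
rewrite -[leRHS]div1r ler_pdivlMr// mulrC.
by rewrite -opprB mulNr -subrX1 opprB gerBl exprn_ge0.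
Qed.

(* With t = c / (1 - r) and u = (a + r t) / (1 - r), the summand is the
   difference at j and j + 1 of r^j (u + t j). *)
Lemma sum_exprn_affine_le (a c : R) n : 0 <= a -> 0 <= c ->
  \sum_(j < n) r ^+ j * (a + c * j%:R)
  <= (a + r * (c / (1 - r))) / (1 - r).
Proof.
move=> a0 c0; have r1' : 0 < 1 - r by rewrite subr_gt0.
set t := c / (1 - r); set u := _ / (1 - r).
have t0 : 0 <= t by rewrite divr_ge0// ltW.
have u0 : 0 <= u by rewrite divr_ge0 ?(ltW r1')// addr_ge0// mulr_ge0.
have -> : \sum_(j < n) r ^+ j * (a + c * j%:R) = u - r ^+ n * (u + t * n%:R).
  have ut : a = (1 - r) * u - r * t by rewrite mulrC divfK ?gt_eqF//; ring.
  have ct : c = (1 - r) * t by rewrite mulrC divfK ?gt_eqF.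
  elim: n => [|n IH]; first by rewrite big_ord0 expr0; ring.
  by rewrite big_ord_recr /= IH {1}ut {1}ct exprS -natr1; ring.
by rewrite gerBl mulr_ge0 ?exprn_ge0// addr_ge0// mulr_ge0.
Qed.

(* The bound of sum_exprn_affine_le at a = 1 + 2 D, c = 2 D. *)
Definition tail_const (D : R) : R :=
  (1 + 2 * D + r * (2 * D / (1 - r))) / (1 - r).

Lemma tail_const_ge0 (D : R) : 0 <= D -> 0 <= tail_const D.
Proof.
move=> D0; have r1' : 0 <= 1 - r by rewrite subr_ge0 ltW.
have D20 : 0 <= 2 * D by exact: mulr_ge0.
rewrite /tail_const divr_ge0//; apply: addr_ge0; first exact: addr_ge0.
by apply: mulr_ge0 => //; exact: divr_ge0.
Qed.

End GeometricSums.

(** * Growth and decay of sector masses along rays *)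

Section SectorMeasure.
Context {R : realType} {V : choiceType} (p : V -> V) (o : V) (lev : V -> int)
  {d : measure_display} {Bd : measurableType d} (emb : Bd -> nat -> V)
  (nu : {measure set Bd -> \bar R}).
Context (tree : tree_with_end p) (levP : level_fn p o lev)
  (bdP : is_boundary p lev emb)
  (mble : @measurable d Bd = <<s range (bsector p emb) >>)
  (succ2 : at_least_two_succs p)
  (nu_fin : forall x : V, (0 < nu (bsector p emb x) < +oo)%E).

Local Notation S := (bsector p emb).
Local Notation m := (mnu p emb nu).

(** [mble] stands for the Borel structure of the boundary: the sectors are the balls of the Gromov
    distance. *)
Lemma measurable_bsector x : measurable (S x).
Proof. by rewrite mble; apply: sub_sigma_algebra; exists x. Qed.
Hint Resolve measurable_bsector : core.

Lemma nu_bsector x : nu (S x) = (m x)%:E.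
Proof.
by rewrite /mnu fineK// ge0_fin_numE ?measure_ge0//; case/andP: (nu_fin x).
Qed.

Lemma mnu_gt0 x : 0 < m x.
Proof. by rewrite -lte_fin -nu_bsector; case/andP: (nu_fin x). Qed.
Hint Resolve mnu_gt0 : core.

Lemma mnu_ge0 x : 0 <= m x. Proof. exact: ltW. Qed.
Hint Resolve mnu_ge0 : core.

Lemma bsector_neq0 x : exists w, S x w.
Proof.
apply/set0P/eqP => Sx0; have := mnu_gt0 x.
by rewrite -lte_fin -nu_bsector Sx0 measure0 ltxx.
Qed.

Lemma le_mnu x y : vle p x y -> m x <= m y.
Proof.
by move=> xy; rewrite -lee_fin -!nu_bsector le_measure ?inE//; exact: bsectorS.
Qed.

(** All vertices [n] steps below [v] have the same level, so no boundary point lies in two of their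
    sectors: these are disjoint subsets of the sector of [v]. *)
Lemma sum_mnu_level v n (s : seq V) : uniq s ->
  {in s, forall x, iter n p x = v} -> \sum_(x <- s) m x <= m v.
Proof.
move=> us sv; have sx x : x \in s -> S x `<=` S v.
  by move=> /sv xv; apply: bsectorS; exists n.
rewrite -lee_fin -sumEFin; under eq_bigr do rewrite -nu_bsector.
rewrite (fsbig_seq _ _ us) -measure_fin_bigcup//.
- rewrite -nu_bsector le_measure ?inE//.
    by apply: fin_bigcup_measurable => // i _; exact: measurable_bsector.
  by apply: bigcup_sub => x /= xs; exact: sx.
- move=> x y /= xs ys [w [wx wy]]; apply: (ble_lev_eq levP bdP wx wy).
  have := sv _ ys; rewrite -(sv _ xs) => /(congr1 lev).
  by rewrite !(lev_iter levP); lia.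
Qed.

(** The radius is chosen so that doubling compares exactly one generation: the open ball of radius
    e^lev(p x) is the sector of [x], and doubling the radius gives the sector of [p x] because 1 < 2
    <= e. *)
Lemma doubling_succ : doubling p o lev emb nu ->
  exists D : R, forall x, m (p x) <= D * m x.
Proof.
move=> [C dC]; exists C => x; have [w wx] := bsector_neq0 x.
have wpx : S (p x) w by apply: (ble_vle wx); exists 1%N.
have := dC w (expR (lev (p x))%:~R).
have levpx : lev (p x) = lev x + 1 by rewrite (proj2 levP).
rewrite (rho_ballE (r := expR (lev (p x))%:~R) tree levP bdP wx); last 2 first.
- by rewrite ltr_expR ltr_int levpx; lia.
- by rewrite levpx.
rewrite (rho_ballE tree levP bdP wpx); last 2 first.
- by have := expR_gt0 ((lev (p x))%:~R : R); lra.
- rewrite intrD expRD mulrC ler_pM2l ?expR_gt0//.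
  by apply: le_trans (expR_ge1Dx _); lra.
by rewrite !nu_bsector lee_fin.
Qed.

(** A sibling of [x] takes at least the fraction 1/D of the mass of [p x], which leaves at most 1 -
    1/D for [x]. *)
Lemma mnu_decay (D : R) : (forall x, m (p x) <= D * m x) ->
  exists2 q : R, 0 < q < 1 & forall x, m x <= q * m (p x).
Proof.
move=> dD; have D0 : 0 < D.
  by rewrite -(pmulr_lgt0 _ (mnu_gt0 o)); apply: lt_le_trans (dD o).
have sib x : exists2 y, y <> x & p y = p x.
  have [y1 [y2 [y12]]] := succ2 (p x); rewrite !inE /succs /= => e1 e2.
  have [/eqP y1x|/eqP y1x] := boolP (y1 == x); last by exists y1.
  by exists y2 => // y2x; apply: y12; rewrite y1x.
have mD x : m x <= (1 - D^-1) * m (p x).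
  have [y yx pyx] := sib x.
  have := @sum_mnu_level (p x) 1 [:: x; y].
  rewrite !big_cons big_nil addr0 => mxy.
  have /mxy {}mxy : uniq [:: x; y] by rewrite /= inE eq_sym andbT; apply/eqP.
  have {}mxy : m x + m y <= m (p x).
    by apply: mxy => z; rewrite !inE => /orP[] /eqP ->.
  have : D^-1 * m (p x) <= m y by rewrite ler_pdivrMl// -pyx.
  lra.
have q0 : 0 < 1 - D^-1.
  by rewrite -(pmulr_lgt0 _ (mnu_gt0 (p o))); apply: lt_le_trans (mD o).
exists (1 - D^-1) => //; rewrite q0 gtrBl invr_gt0//.
Qed.

Context (q : R) (q01 : 0 < q < 1) (mq : forall x, m x <= q * m (p x)).

Lemma mnu_iter_le n x : m x <= q ^+ n * m (iter n p x).
Proof.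
have /andP[q0 _] := q01; elim: n => [|n IH]; first by rewrite expr0 mul1r.
by apply: le_trans IH _; rewrite exprSr -mulrA ler_pM2l ?exprn_gt0.
Qed.

Lemma mnu_iter_powR_le (a : R) n x : 0 < a ->
  m x `^ a <= (q `^ a) ^+ n * m (iter n p x) `^ a.
Proof.
move=> a0; have /andP[q0 _] := q01.
have -> : (q `^ a) ^+ n = (q ^+ n) `^ a.
  by rewrite -powR_mulrn ?powR_ge0// -powR_mulrn ?ltW// -!powRrM mulrC.
rewrite -powRM ?exprn_ge0 ?(ltW q0)//.
by apply: ge0_ler_powR; rewrite ?nnegrE ?mulr_ge0 ?exprn_ge0 ?mnu_iter_le// ltW.
Qed.

Lemma powR_lt1 (a : R) : 0 < a -> q `^ a < 1.
Proof.
move=> a0; have /andP[q0 q1] := q01.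
have -> : 1 = 1 `^ a :> R by rewrite powR1.
by apply: gt0_ltr_powR; rewrite ?nnegrE// ltW.
Qed.

(** Group the vertices by their depth n below [v]: the masses at one depth add up to at most m(v),
    and each factor m(x)^a is at most r^n m(v)^a. A geometric series remains. *)
Lemma sum_mnu_powR_le v (a : R) (s : seq V) : 0 < a -> uniq s ->
  {in s, forall x, vle p x v} ->
  \sum_(x <- s) m x * m x `^ a <= m v * m v `^ a / (1 - q `^ a).
Proof.
move=> a0 us sv; set r := q `^ a.
have r0 : 0 <= r by exact: powR_ge0.
have r1 : r < 1 by exact: powR_lt1.
pose dep x := `|lev v - lev x|%N.
have depE x : x \in s -> iter (dep x) p x = v.
  move=> /sv [n nv]; suff -> : dep x = n by [].
  by rewrite /dep -nv (lev_iter levP); lia.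
pose N := (\max_(x <- s) dep x).+1.
have depN x : x \in s -> (dep x < N)%N.
  by move=> xs; rewrite ltnS; exact: leq_bigmax_seq.
(* Each inner sum has the single index [dep x]; it is introduced so that the two sums can be
   exchanged. *)
apply: (@le_trans _ _ (\sum_(x <- s)
    \sum_(n < N | dep x == n) m x * (r ^+ n * m v `^ a))).
  rewrite big_seq [leRHS]big_seq; apply: ler_sum => x xs.
  rewrite (big_pred1 (Ordinal (depN x xs))) => [|i]; last first.
    by rewrite -[RHS]val_eqE eq_sym.
  by rewrite ler_pM2l//= -[in leRHS](depE x xs); exact: mnu_iter_powR_le.
rewrite (exchange_big_dep xpredT)//=.
apply: (@le_trans _ _ (\sum_(n < N) m v * (r ^+ n * m v `^ a))).
  apply: ler_sum => n _; rewrite -mulr_suml ler_wpM2r//.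
    by rewrite mulr_ge0 ?exprn_ge0 ?powR_ge0.
  rewrite -big_filter; apply: (@sum_mnu_level _ n); first exact: filter_uniq.
  by move=> x; rewrite mem_filter => /andP[/eqP <-]; exact: depE.
rewrite -mulr_sumr -mulr_suml -mulrA ler_pM2l// mulrC ler_wpM2l ?powR_ge0//.
exact: sum_exprn_le.
Qed.

End SectorMeasure.

(** * Modulus, real part and imaginary part *)

Section ComplexModulus.
Context {R : realType}.
Implicit Types z w : R[i].

Lemma normc_ge0 z : 0 <= normc z.
Proof. by case: z => a b; exact: sqrtr_ge0. Qed.

Lemma ler_Re_normc z : `|complex.Re z| <= normc z.
Proof.
by case: z => a b /=; rewrite -sqrtr_sqr ler_wsqrtr// lerDl sqr_ge0.
Qed.

Lemma ler_Im_normc z : `|complex.Im z| <= normc z.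
Proof.
by case: z => a b /=; rewrite -sqrtr_sqr ler_wsqrtr// lerDr sqr_ge0.
Qed.

Lemma normc_ler_ReIm z : normc z <= `|complex.Re z| + `|complex.Im z|.
Proof.
case: z => a b /=; rewrite -[leRHS]ger0_norm ?addr_ge0// -sqrtr_sqr.
rewrite ler_wsqrtr// sqrrD !real_normK ?num_real// lerD2r lerDl.
by rewrite mulrn_wge0// mulr_ge0.
Qed.

Lemma cReB z w : complex.Re (z - w) = complex.Re z - complex.Re w.
Proof. by case: z w => [? ?] [? ?]. Qed.

Lemma cImB z w : complex.Im (z - w) = complex.Im z - complex.Im w.
Proof. by case: z w => [? ?] [? ?]. Qed.

Lemma cReM z w : complex.Re (z * w) =
  complex.Re z * complex.Re w - complex.Im z * complex.Im w.
Proof. by case: z w => [? ?] [? ?]. Qed.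

Lemma cImM z w : complex.Im (z * w) =
  complex.Re z * complex.Im w + complex.Im z * complex.Re w.
Proof. by case: z w => [? ?] [? ?]. Qed.

End ComplexModulus.

(** * Integration of complex-valued functions *)

Section ComplexIntegral.
Context {R : realType} {d : measure_display} {T : measurableType d}
  (mu : {measure set T -> \bar R}).
Implicit Types (D : set T) (f g : T -> R[i]).

Definition cmeasurable D f :=
  measurable_fun D (fun w => complex.Re (f w)) /\
  measurable_fun D (fun w => complex.Im (f w)).

Lemma cmeasurableS D E f : measurable E -> D `<=` E ->
  cmeasurable E f -> cmeasurable D f.
Proof. by move=> mE DE [mr mi]; split; apply: measurable_funS DE _. Qed.

Lemma cmeasurable_cst D (c : R[i]) : cmeasurable D (fun=> c).
Proof. by split; exact: measurable_cst. Qed.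

Lemma cmeasurableB D f g : cmeasurable D f -> cmeasurable D g ->
  cmeasurable D (fun w => f w - g w).
Proof.
move=> [fr fi] [gr gi]; split.
  by under eq_fun do rewrite cReB; exact: measurable_funB.
by under eq_fun do rewrite cImB; exact: measurable_funB.
Qed.

Lemma cmeasurableM D f g : cmeasurable D f -> cmeasurable D g ->
  cmeasurable D (fun w => f w * g w).
Proof.
move=> [fr fi] [gr gi]; split.
  under eq_fun do rewrite cReM.
  by apply: measurable_funB; exact: measurable_funM.
under eq_fun do rewrite cImM.
by apply: measurable_funD; exact: measurable_funM.
Qed.

Lemma measurable_normc D f : measurable D -> cmeasurable D f ->
  measurable_fun D (fun w => normc (f w)).
Proof.
move=> mD [fr fi].
rewrite (_ : (fun w => _) =
    (fun w => Num.sqrt (complex.Re (f w) ^+ 2 + complex.Im (f w) ^+ 2))).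
  apply: (@measurableT_comp _ _ _ _ _ _ (@Num.sqrt R)).
    by apply: continuous_measurable_fun; exact: sqrt_continuous.
  by apply: measurable_funD; exact: measurable_funX.
by apply/funext => w; case: (f w).
Qed.

Lemma cintegrable_cmeasurable D f : cintegrable mu D f -> cmeasurable D f.
Proof.
by move=> [/integrableP[/measurable_EFinP + _]
  /integrableP[/measurable_EFinP + _]].
Qed.

Lemma cintegrable_normc D f : measurable D -> cintegrable mu D f ->
  mu.-integrable D (fun w => (normc (f w))%:E).
Proof.
move=> mD fi; have [ir ii] := fi.
apply: (@le_integrable _ _ _ _ D mD _
  (fun w => (`|complex.Re (f w)| + `|complex.Im (f w)|)%:E)).
- apply/measurable_EFinP/measurable_normc => //.
  exact: cintegrable_cmeasurable fi.
- move=> w Dw /=; rewrite lee_fin [leLHS]ger0_norm ?normc_ge0//.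
  rewrite [leRHS]ger0_norm ?addr_ge0//.
  exact: normc_ler_ReIm.
- have := integrableD mD (integrable_norm ir) (integrable_norm ii).
  by apply: eq_integrable.
Qed.

Lemma cintegrable_of_normc D f : measurable D -> cmeasurable D f ->
  mu.-integrable D (fun w => (normc (f w))%:E) -> cintegrable mu D f.
Proof.
move=> mD [fr fi] fn; split; apply: (le_integrable mD _ _ fn) => //=;
  try exact/measurable_EFinP.
- by move=> w Dw; rewrite lee_fin [leRHS]ger0_norm ?normc_ge0 ?ler_Re_normc.
- by move=> w Dw; rewrite lee_fin [leRHS]ger0_norm ?normc_ge0 ?ler_Im_normc.
Qed.

Lemma cintegrableB D f g : measurable D ->
  cintegrable mu D f -> cintegrable mu D g ->
  cintegrable mu D (fun w => f w - g w).
Proof.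
move=> mD [fr fi] [gr gi]; split.
  apply: eq_integrable (integrableB mD fr gr) => // w _.
  by rewrite cReB.
apply: eq_integrable (integrableB mD fi gi) => // w _.
by rewrite cImB.
Qed.

Lemma cintegralB D f g : measurable D ->
  cintegrable mu D f -> cintegrable mu D g ->
  cintegral mu D (fun w => f w - g w) = cintegral mu D f - cintegral mu D g.
Proof.
move=> mD [fr fi] [gr gi]; rewrite /cintegral; congr Complex.
  rewrite -[RHS]RintegralB//; apply: eq_Rintegral => w _.
  by rewrite cReB.
rewrite -[RHS]RintegralB//; apply: eq_Rintegral => w _.
by rewrite cImB.
Qed.

Lemma cintegrableZr D f (c : R[i]) : measurable D ->
  cintegrable mu D f -> cintegrable mu D (fun w => f w * c).
Proof.
move=> mD [fr fi]; split.
  have := integrableB mD (integrableZr mD (complex.Re c) fr)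
    (integrableZr mD (complex.Im c) fi).
  by apply: eq_integrable => // w _; rewrite cReM.
have := integrableD mD (integrableZr mD (complex.Im c) fr)
  (integrableZr mD (complex.Re c) fi).
by apply: eq_integrable => // w _; rewrite cImM.
Qed.

Lemma cintegralZr D f (c : R[i]) : measurable D -> cintegrable mu D f ->
  cintegral mu D (fun w => f w * c) = cintegral mu D f * c.
Proof.
move=> mD [fr fi].
have intZ (h : T -> R) k : mu.-integrable D (EFin \o h) ->
    mu.-integrable D (EFin \o (fun w => h w * k)).
  move=> ih; have := integrableZr mD k ih.
  by apply: eq_integrable.
rewrite /cintegral; apply/eqP; rewrite eq_complex cReM cImM /=.
rewrite -!RintegralZr// -RintegralB//; try exact: intZ.
rewrite -RintegralD//; try exact: intZ.
apply/andP; split; apply/eqP; apply: eq_Rintegral => w _.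
  by rewrite cReM.
by rewrite cImM.
Qed.

Lemma cintegrable_cst D (c : R[i]) : measurable D -> (mu D < +oo)%E ->
  cintegrable mu D (fun=> c).
Proof.
move=> mD Doo; split; apply/integrableP; split; try exact: measurable_cst.
  by rewrite integral_cst//= lte_mul_pinfty.
by rewrite integral_cst//= lte_mul_pinfty.
Qed.

Lemma EFin_Rintegral D (h : T -> R) : measurable D ->
  mu.-integrable D (fun w => (h w)%:E) ->
  (Rintegral mu D h)%:E = (\int[mu]_(w in D) (h w)%:E)%E.
Proof.
by move=> mD ih; rewrite /Rintegral fineK//; exact: integrable_fin_num.
Qed.

(* The sharp constant is 1; bounding real and imaginary parts separately is
   enough here. *)
Lemma normc_cintegral_le D f : measurable D -> cintegrable mu D f ->
  normc (cintegral mu D f) <= 2 * Rintegral mu D (fun w => normc (f w)).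
Proof.
move=> mD fi; have [ir ii] := fi; have fn := cintegrable_normc mD fi.
apply: le_trans (normc_ler_ReIm _) _; rewrite /= mulr_natl mulr2n.
apply: lerD; apply: le_trans (le_normr_Rintegral _ _) _ => //;
  apply: le_Rintegral => //; try exact: integrable_norm.
- by move=> w _; exact: ler_Re_normc.
- by move=> w _; exact: ler_Im_normc.
Qed.

End ComplexIntegral.

(** * Mean oscillation and the drift of averages along a ray *)

Section Oscillation.
Context {R : realType} {V : choiceType} (p : V -> V) (o : V) (lev : V -> int)
  {d : measure_display} {Bd : measurableType d} (emb : Bd -> nat -> V)
  (nu : {measure set Bd -> \bar R}).
Context (tree : tree_with_end p) (levP : level_fn p o lev)
  (bdP : is_boundary p lev emb)
  (mble : @measurable d Bd = <<s range (bsector p emb) >>)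
  (nu_fin : forall x : V, (0 < nu (bsector p emb x) < +oo)%E).
Context (b : Bd -> R[i]) (bL : L1loc p emb nu b).

Local Notation S := (bsector p emb).
Local Notation m := (mnu p emb nu).
Local Notation bv := (bavg p emb nu b).

Let mS x : measurable (S x). Proof. exact: measurable_bsector. Qed.
Let m0 x : 0 < m x. Proof. exact: mnu_gt0. Qed.
Hint Resolve mS m0 : core.

Lemma bigcup_bsector : \bigcup_n S (iter n p o) = setT.
Proof.
by apply/seteqP; split=> // w _; have [n] := ble_ray emb tree w o; exists n.
Qed.

(** Local integrability gives measurability on each sector, and the sectors along the ray from [o]
    form a countable cover of the boundary. *)
Lemma L1loc_cmeasurable : cmeasurable setT b.
Proof.
rewrite -bigcup_bsector; split; apply/measurable_fun_bigcup => // n;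
  by have [] := cintegrable_cmeasurable (bL (iter n p o)).
Qed.

Lemma cintegrable_sub_cst x c : cintegrable nu (S x) (fun w => b w - c).
Proof.
apply: cintegrableB => //; apply: cintegrable_cst => //.
by case/andP: (nu_fin x).
Qed.

Lemma integrable_normc_sub x c :
  nu.-integrable (S x) (fun w => (normc (b w - c))%:E).
Proof. by apply: cintegrable_normc => //; exact: cintegrable_sub_cst. Qed.
Hint Resolve integrable_normc_sub : core.

Lemma bavgB x c :
  bv x - c = Complex (m x)^-1 0 * cintegral nu (S x) (fun w => b w - c).
Proof.
have nuoo : (nu (S x) < +oo)%E by case/andP: (nu_fin x).
rewrite cintegralB//; last exact: cintegrable_cst.
rewrite mulrBr; congr (_ - _).
rewrite /cintegral !Rintegral_cst//.
rewrite -/(m x); case: c => c1 c2; apply/eqP; rewrite eq_complex cReM cImM /=.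
by rewrite !mul0r subr0 addr0 ![(m x)^-1 * _]mulrC !mulfK ?eqxx// gt_eqF.
Qed.

Lemma normc_bavgB_le x c : normc (bv x - c) <=
  2 * (m x)^-1 * Rintegral nu (S x) (fun w => normc (b w - c)).
Proof.
rewrite bavgB Normc.normcM.
have -> : normc (Complex (m x)^-1 0) = (m x)^-1.
  by rewrite /= expr0n addr0 sqrtr_sqr ger0_norm// invr_ge0 ltW.
rewrite [2 * _]mulrC -mulrA ler_pM2l ?invr_gt0//.
by apply: normc_cintegral_le => //; exact: cintegrable_sub_cst.
Qed.

Context (D : R) (dD : forall x, m (p x) <= D * m x).
Context (M : R) (bM : forall x, (m x)^-1 *
  Rintegral nu (S x) (fun w => normc (b w - bv x)) <= M).

Lemma bmo_ge0 : 0 <= M.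
Proof.
apply: le_trans (bM o); rewrite mulr_ge0 ?invr_ge0 ?(ltW (m0 o))//.
by apply: Rintegral_ge0 => w _; exact: normc_ge0.
Qed.

Lemma doubling_ge0 : 0 <= D.
Proof.
by apply/ltW; rewrite -(pmulr_lgt0 _ (m0 o)); apply: lt_le_trans (dD o).
Qed.

Lemma Rintegral_dev_le x :
  Rintegral nu (S x) (fun w => normc (b w - bv x)) <= M * m x.
Proof. by rewrite -ler_pdivrMr// mulrC. Qed.

(** Averaging the deviation from [bv (p x)] over the smaller sector costs the ratio of the masses,
    at most [D]; the 2 comes from [normc_cintegral_le]. *)
Lemma bavg_succ_le x : normc (bv x - bv (p x)) <= 2 * D * M.
Proof.
apply: le_trans (normc_bavgB_le _ _) _; rewrite -!mulrA ler_pM2l//.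
rewrite ler_pdivrMl//; apply: (@le_trans _ _ (M * m (p x))); last first.
  by rewrite mulrA [m x * D]mulrC [M * _]mulrC ler_wpM2r ?bmo_ge0.
apply: le_trans (Rintegral_dev_le (p x)).
have pS : S x `<=` S (p x) by apply: bsectorS; exists 1%N.
rewrite -lee_fin !EFin_Rintegral//.
apply: ge0_subset_integral => //; last first.
  by move=> w _; rewrite lee_fin normc_ge0.
by have /integrableP[] := integrable_normc_sub (p x) (bv (p x)).
Qed.

Lemma bavg_iter_le v j :
  normc (bv (iter j p v) - bv v) <= 2 * D * M * j%:R.
Proof.
elim: j => [|j IH]; first by rewrite subrr mulr0 Normc.normc0.
have -> : bv (iter j.+1 p v) - bv v = - (bv (iter j p v) - bv (iter j.+1 p v))
    + (bv (iter j p v) - bv v) by ring.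
apply: le_trans (le_normcD _ _) _; rewrite normcN -(natr1 j) mulrDr mulr1 addrC.
by apply: lerD => //; exact: bavg_succ_le.
Qed.

(** Insert the average at y = p^j v: per unit of mass, the oscillation around it costs M and the
    drift of the averages from v to y costs 2 D M j. *)
Lemma integral_dev_iter_le v j :
  (\int[nu]_(w in S (iter j p v)) (normc (b w - bv v))%:E
   <= (M * (1 + 2 * D * j%:R) * m (iter j p v))%:E)%E.
Proof.
rewrite -EFin_Rintegral// lee_fin; set y := iter j p v.
have icst k : nu.-integrable (S y) (EFin \o (fun=> k)).
  have nuoo : (nu (S y) < +oo)%E by case/andP: (nu_fin y).
  by have [] := cintegrable_cst (Complex k 0) (mS y) nuoo.
apply: (@le_trans _ _ (Rintegral nu (S y)
    (fun w => normc (b w - bv y) + 2 * D * M * j%:R))).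
  apply: le_Rintegral => //.
  - exact: integrable_normc_sub.
  - exact: (integrableD (mS y) (integrable_normc_sub y (bv y))
      (icst (2 * D * M * j%:R))).
- move=> w _; have -> : b w - bv v = (b w - bv y) + (bv y - bv v) by ring.
  by apply: le_trans (le_normcD _ _) _; rewrite lerD2l bavg_iter_le.
rewrite RintegralD//; last exact: integrable_normc_sub.
rewrite Rintegral_cst// -/(m y).
have := Rintegral_dev_le y; lra.
Qed.

End Oscillation.

(** * The Carleson bound for a function of bounded mean oscillation *)

Section OperatorBound.
Context {R : realType} {V : choiceType} (p : V -> V) (o : V) (lev : V -> int)
  {d : measure_display} {Bd : measurableType d} (emb : Bd -> nat -> V)
  (nu : {measure set Bd -> \bar R}).
Context (tree : tree_with_end p) (levP : level_fn p o lev)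
  (bdP : is_boundary p lev emb)
  (mble : @measurable d Bd = <<s range (bsector p emb) >>)
  (nu_fin : forall x : V, (0 < nu (bsector p emb x) < +oo)%E).
Context (b : Bd -> R[i]) (bL : L1loc p emb nu b).

Local Notation S := (bsector p emb).
Local Notation m := (mnu p emb nu).
Local Notation bv := (bavg p emb nu b).

Context (D : R) (dD : forall x, m (p x) <= D * m x).
Context (M : R) (bM : forall x, (m x)^-1 *
  Rintegral nu (S x) (fun w => normc (b w - bv x)) <= M).
Context (q : R) (q01 : 0 < q < 1) (mq : forall x, m x <= q * m (p x)).
Context (a : R) (a0 : 0 < a) (K : V -> Bd -> R[i]) (KA1 : kerA1 nu K)
  (KA2 : kerA2 p emb nu K) (KA3 : kerA3 p o lev emb nu a K).

Local Notation r := (q `^ a).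

Let mS x : measurable (S x). Proof. exact: measurable_bsector. Qed.
Let m0 x : 0 < m x. Proof. exact: mnu_gt0. Qed.
Hint Resolve mS m0 : core.
Let M0 : 0 <= M. Proof. exact: bmo_ge0 bM. Qed.
Let D0 : 0 <= D. Proof. exact: doubling_ge0 dD. Qed.
Let r0 : 0 <= r. Proof. exact: powR_ge0. Qed.
Let r1 : r < 1. Proof. exact: powR_lt1. Qed.

Local Notation dev v w := (normc (b w - bv v)).

Lemma measurable_kernel_dev x v :
  measurable_fun setT (fun w => (normc (K x w) * dev v w)%:E).
Proof.
apply/measurable_EFinP/measurable_funM; apply: measurable_normc => //.
  by apply: cintegrable_cmeasurable; exact: (KA1 x).1.
by apply: cmeasurableB; [exact: L1loc_cmeasurable bL|exact: cmeasurable_cst].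
Qed.

Lemma kernel_dev_ge0 x v w : (0 <= (normc (K x w) * dev v w)%:E)%E.
Proof. by rewrite lee_fin mulr_ge0 ?normc_ge0. Qed.
Hint Resolve kernel_dev_ge0 : core.

Lemma measurable_dev v A :
  measurable A -> measurable_fun A (fun w => (dev v w)%:E).
Proof.
move=> mA; apply/measurable_EFinP; apply: measurable_normc => //.
apply: (@cmeasurableS _ _ _ _ setT) => //.
by apply: cmeasurableB; [exact: L1loc_cmeasurable bL|exact: cmeasurable_cst].
Qed.

(** Masses increase along a ray, so the confluent in (A3) may be replaced by any vertex below it.
    The power is split as m(y)^a m(y) so that the last factor can cancel the mass of the sector of
    [y]. *)
Lemma kernel_le x y w : vle p y (conf_vb p o lev emb x w) ->
  normc (K x w) <= m x `^ a / (m y `^ a * m y).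
Proof.
move=> yc; apply: le_trans (KA3 x w) _; rewrite ler_wpM2l ?powR_ge0//.
set c := conf_vb _ _ _ _ _ _.
rewrite powRD; last by rewrite (gt_eqF (m0 c)) implybT.
rewrite powRr1 ?(ltW (m0 _))// lef_pV2 ?posrE ?mulr_gt0 ?powR_gt0//.
have yc' : m y <= m c by exact: (le_mnu mble nu_fin yc).
by apply: ler_pM; rewrite ?powR_ge0 ?(ltW (m0 y))//;
  apply: ge0_ler_powR; rewrite ?nnegrE ?(ltW (m0 _)) ?(ltW a0).
Qed.

Lemma integral_kernel_dev_le A k x y v : measurable A -> A `<=` S y ->
  (forall w, A w -> normc (K x w) <= k) -> 0 <= k ->
  (\int[nu]_(w in A) (normc (K x w) * dev v w)%:E
   <= k%:E * \int[nu]_(w in S y) (dev v w)%:E)%E.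
Proof.
move=> mA AS Kk k0.
have dev0 (w : Bd) : (0 <= (dev v w)%:E)%E by rewrite lee_fin normc_ge0.
apply: (@le_trans _ _ (\int[nu]_(w in A) (k%:E * (dev v w)%:E))%E).
  apply: ge0_le_integral => //.
  - apply: measurable_funS (@measurable_kernel_dev x v) => //.
  - by apply: emeasurable_funM => //; exact: measurable_dev.
  - by move=> w Aw; rewrite -EFinM lee_fin ler_wpM2r ?normc_ge0 ?Kk.
rewrite ge0_integralZl_EFin//; last exact: measurable_dev.
rewrite lee_wpmul2l//; apply: ge0_subset_integral => //.
exact: measurable_dev.
Qed.

(** On the ring, [kernel_le] applies with y = p^(j+1) v. The deviation is integrated over the whole
    sector of y, whose mass cancels one factor, and the decay of masses trades m(y)^(-a) for r^(j+1)
    m(v)^(-a). *)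
Lemma integral_kernel_ring_le x v j : vle p x v ->
  (\int[nu]_(w in S (iter j.+1 p v) `\` S (iter j p v))
      (normc (K x w) * dev v w)%:E
   <= (m x `^ a / m v `^ a * M * (r ^+ j * (1 + 2 * D + 2 * D * j%:R)))%:E)%E.
Proof.
move=> xv; set y := iter j.+1 p v.
have k0 : 0 <= m x `^ a / (m y `^ a * m y).
  by rewrite divr_ge0 ?mulr_ge0 ?powR_ge0// ltW.
apply: (le_trans (@integral_kernel_dev_le _ _ x y v _ (@subDsetl _ _ _) _ k0)).
- exact: measurableD.
- move=> w [_ wNj]; apply: kernel_le.
  have [xc wc _] := conf_vbP emb tree levP x w.
  have xj : vle p x (iter j p v) by apply: vle_trans xv _; exists j.
  have xy : vle p x y by apply: vle_trans xv _; exists j.+1.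
  (* A confluent strictly below [y] would lie at or below p^j v, and [w] would belong to the removed
     inner sector. *)
  apply: (vle_total levP xy xc); rewrite leNgt; apply/negP => lt.
  apply: wNj; apply: ble_vle wc _; apply: (vle_total levP xc xj).
  by move: lt; rewrite /y !(lev_iter levP); lia.
apply: le_trans (lee_wpmul2l _
  (integral_dev_iter_le o mble nu_fin bL dD bM v j.+1)) _.
  by rewrite lee_fin.
rewrite -EFinM lee_fin -/y.
have -> : m x `^ a / (m y `^ a * m y) * (M * (1 + 2 * D * j.+1%:R) * m y) =
    m x `^ a * (M * (1 + 2 * D * j.+1%:R)) * (m y `^ a)^-1.
  by field; rewrite !gt_eqF ?powR_gt0.
have -> : m x `^ a / m v `^ a * M * (r ^+ j * (1 + 2 * D + 2 * D * j%:R)) =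
    m x `^ a * (M * (1 + 2 * D * j.+1%:R)) * (r ^+ j / m v `^ a).
  by rewrite -(natr1 j); ring.
rewrite ler_wpM2l//.
  by rewrite !mulr_ge0 ?powR_ge0// addr_ge0 ?mulr_ge0.
rewrite ler_pdivlMr ?powR_gt0// ler_pdivrMl ?powR_gt0//.
(* Decay over j + 1 steps gives r^(j+1); one factor r <= 1 is given away. *)
apply: le_trans (mnu_iter_powR_le nu_fin q01 mq j.+1 v a0) _.
rewrite mulrC -/y ler_wpM2l ?powR_ge0// exprS ler_piMl ?exprn_ge0//.
exact: ltW.
Qed.

(** The ring of [w] is found from the least j with p^j v on the line of [w], which is positive when
    [w] is off the sector of [v]. *)
Lemma setC_bsector v :
  ~` S v = \bigcup_j (S (iter j.+1 p v) `\` S (iter j p v)).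
Proof.
apply/seteqP; split=> [w wNv|w [j _ [_ wNj]] wv]; last first.
  by apply: wNj; apply: ble_vle wv _; exists j.
have exj : exists j, `[< S (iter j p v) w >].
  by have [j wj] := ble_ray emb tree w v; exists j; apply/asboolP.
case: (ex_minnP exj) => -[|j] /asboolP wj jmin; first by case: wNv.
exists j => //; split=> // wj'.
have /jmin : `[< S (iter j p v) w >] by apply/asboolP.
by rewrite ltnn.
Qed.

(** Sectors grow along the ray, so an earlier ring is contained in what a later one removes. *)
Lemma trivIset_rings v :
  trivIset setT (fun j => S (iter j.+1 p v) `\` S (iter j p v)).
Proof.
suff lt i j w : (i < j)%N -> S (iter i.+1 p v) w -> S (iter j p v) w.
  move=> i j _ _ [w [[wi wNi] [wj wNj]]].
  have [ij|ij|//] := ltngtP i j; first by case: wNj; exact: lt ij wi.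
  by case: wNi; exact: lt ij wj.
by move=> ij wi; apply: ble_vle wi _; exists (j - i.+1)%N; rewrite -iterD subnK.
Qed.

Lemma integral_kernel_setC_le x v : vle p x v ->
  (\int[nu]_(w in ~` S v) (normc (K x w) * dev v w)%:E
   <= (m x `^ a / m v `^ a * M * tail_const r D)%:E)%E.
Proof.
move=> xv; rewrite setC_bsector ge0_integral_bigcup//=; last 3 first.
- by move=> j; exact: measurableD.
- apply: measurable_funS (@measurable_kernel_dev x v) => //.
- exact: trivIset_rings.
apply: lime_le.
  by apply: is_cvg_nneseries => j _ _; apply: integral_ge0 => w _.
apply: nearW => n.
apply: le_trans (lee_sum _ (fun j _ => integral_kernel_ring_le j xv)) _.
rewrite sumEFin lee_fin -mulr_sumr ler_wpM2l//.
  by rewrite mulr_ge0// divr_ge0 ?powR_ge0.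
rewrite big_mkord; apply: sum_exprn_affine_le => //; last by rewrite mulr_ge0.
by rewrite addr_ge0 ?mulr_ge0.
Qed.

Lemma integral_kernel_devE x v :
  (\int[nu]_w (normc (K x w) * dev v w)%:E =
   \int[nu]_(w in S v) (normc (K x w) * dev v w)%:E +
   \int[nu]_(w in ~` S v) (normc (K x w) * dev v w)%:E)%E.
Proof.
rewrite -ge0_integral_setU ?setUv//.
- exact: measurableC.
- exact: measurable_kernel_dev.
- by rewrite disj_set2E setICr.
Qed.

(** Write b as its deviation from [bv x] plus a constant. The constant is absorbed by the
    integrability in (A1); the deviation is controlled by [kernel_le] on the sector of [x] and by
    the rings off it. *)
Lemma cintegrable_kernel x : cintegrable nu setT (fun w => K x w * b w).
Proof.
have [iK _] := KA1 x.
have mK : cmeasurable setT (fun w => K x w * (b w - bv x)).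
  apply: cmeasurableM; first exact: cintegrable_cmeasurable iK.
  by apply: cmeasurableB; [exact: L1loc_cmeasurable bL|exact: cmeasurable_cst].
suff i1 : cintegrable nu setT (fun w => K x w * (b w - bv x)).
  have -> : (fun w => K x w * b w) =
      (fun w => K x w * (b w - bv x) - K x w * (- bv x)).
    by apply/funext => w; ring.
  by apply: cintegrableB => //; exact: cintegrableZr.
apply: cintegrable_of_normc => //.
have -> : (fun w => (normc (K x w * (b w - bv x)))%:E) =
    (fun w => (normc (K x w) * dev x w)%:E).
  by apply/funext => w; rewrite Normc.normcM.
apply/integrableP; split; first exact: measurable_kernel_dev.
under eq_integral do rewrite gee0_abs//.
rewrite integral_kernel_devE lte_add_pinfty//; last first.
  by apply: le_lt_trans (integral_kernel_setC_le (vle_refl p x)) (ltry _).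
have k0 : 0 <= m x `^ a / (m x `^ a * m x).
  by rewrite divr_ge0 ?mulr_ge0 ?powR_ge0// ltW.
apply: le_lt_trans (@integral_kernel_dev_le _ _ x x x
  (mS x) (@subset_refl _ _) _ k0) _.
  move=> w wx; apply: kernel_le.
  by have [] := conf_vbP emb tree levP x w.
rewrite lte_mul_pinfty ?lee_fin//.
apply: le_lt_trans (integral_dev_iter_le o mble nu_fin bL dD bM x 0) (ltry _).
Qed.

Lemma integrable_kernel_dev x v :
  nu.-integrable setT (fun w => (normc (K x w) * dev v w)%:E).
Proof.
have [iK _] := KA1 x.
have -> : (fun w => (normc (K x w) * dev v w)%:E) =
    (fun w => (normc (K x w * b w - K x w * bv v))%:E).
  by apply/funext => w; rewrite -mulrBr Normc.normcM.
apply: cintegrable_normc => //; apply: cintegrableB => //.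
  exact: cintegrable_kernel.
exact: cintegrableZr.
Qed.

(** The mean zero condition in (A1) lets b be replaced by its deviation from [bv v]; the integral is
    then split at the sector of [v]. *)
Lemma normc_Kapply_le x v : vle p x v -> normc (Kapply nu K b x) <=
  2 * (Rintegral nu (S v) (fun w => normc (K x w) * dev v w)
       + m x `^ a / m v `^ a * M * tail_const r D).
Proof.
move=> xv; have [iK K0] := KA1 x.
have iKc : cintegrable nu setT (fun w => K x w * bv v) by exact: cintegrableZr.
have -> : Kapply nu K b x = cintegral nu setT (fun w => K x w * (b w - bv v)).
  under eq_fun do rewrite mulrBr.
  rewrite cintegralB//; last exact: cintegrable_kernel.
  by rewrite cintegralZr// K0 mul0r subr0.
have iKd : cintegrable nu setT (fun w => K x w * (b w - bv v)).
  under eq_fun do rewrite mulrBr.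
  by apply: cintegrableB => //; exact: cintegrable_kernel.
apply: le_trans (normc_cintegral_le _ iKd) _ => //; rewrite ler_pM2l//.
under eq_Rintegral do rewrite Normc.normcM.
rewrite -lee_fin EFinD !EFin_Rintegral//; last 2 first.
- by apply: integrableS (integrable_kernel_dev x v).
- exact: integrable_kernel_dev.
rewrite integral_kernel_devE leeD2l//; exact: integral_kernel_setC_le.
Qed.

(** The essential supremum has to be taken over a space of positive mass, which the sector of [o]
    supplies. *)
Lemma CKe_ge0 : (0 <= CKe p emb nu K)%E.
Proof.
apply: ess_sup_gee.
  have /andP[+ _] := nu_fin o; move=> /lt_le_trans; apply.
  by rewrite le_measure ?inE.
apply: nearW => w; apply: esum_ge0 => x _.
by rewrite lee_fin mulr_ge0 ?normc_ge0// ltW.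
Qed.

Lemma CKeE : CKe p emb nu K = (fine (CKe p emb nu K))%:E.
Proof. by rewrite fineK// ge0_fin_numE ?CKe_ge0. Qed.

(** The sum over the tree is a supremum of finite sums, so (A2) is passed to finite families, which
    are measurable in [w] and can be integrated. *)
Lemma sum_kernel_ae (s : seq V) : uniq s -> {ae nu, forall w,
  \sum_(x <- s) normc (K x w) * m x <= fine (CKe p emb nu K)}.
Proof.
move=> us; apply: filterS (ess_sup_ge nu (kerSum p emb nu K)) => w.
rewrite -/(CKe p emb nu K) CKeE -lee_fin; apply: le_trans; apply: esum_ge.
exists [set` s]; first by split=> //; exact: finite_seq.
by rewrite -fsbig_seq// sumEFin.
Qed.

(** Exchanging sum and integral puts the sum of |K(x, w)| m(x) under the integral, where C_K bounds
    it for almost every [w]; what remains is the oscillation of b on the sector of [v]. *)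
Lemma sum_Rintegral_kernel_le v (s : seq V) : uniq s ->
  \sum_(x <- s) Rintegral nu (S v) (fun w => normc (K x w) * dev v w) * m x
  <= fine (CKe p emb nu K) * (M * m v).
Proof.
move=> us; have C0 : 0 <= fine (CKe p emb nu K) by rewrite fine_ge0 ?CKe_ge0.
rewrite -lee_fin -sumEFin.
have E x : (Rintegral nu (S v) (fun w => normc (K x w) * dev v w) * m x)%:E =
    (\int[nu]_(w in S v) ((m x)%:E * (normc (K x w) * dev v w)%:E))%E.
  rewrite ge0_integralZl_EFin ?(ltW (m0 x))//; last first.
    exact: measurable_funS (@measurable_kernel_dev x v).
  rewrite mulrC EFinM EFin_Rintegral//.
  by apply: integrableS (integrable_kernel_dev x v).
under eq_bigr do rewrite E.
have mKd x : measurable_fun (S v)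
    (fun w => ((m x)%:E * (normc (K x w) * dev v w)%:E)%E).
  apply: emeasurable_funM; first exact: measurable_cst.
  exact: measurable_funS (@measurable_kernel_dev x v).
have Kd0 x w : (0 <= (m x)%:E * (normc (K x w) * dev v w)%:E)%E.
  by rewrite mule_ge0// lee_fin ltW.
rewrite -ge0_integral_sum//.
have dev0 (w : Bd) : (0 <= (dev v w)%:E)%E by rewrite lee_fin normc_ge0.
apply: (@le_trans _ _ (\int[nu]_(w in S v)
    ((fine (CKe p emb nu K))%:E * (dev v w)%:E))%E).
  apply: ae_ge0_le_integral => //.
  - by move=> w _; apply: sume_ge0.
  - exact: emeasurable_sum.
  - by move=> w _; rewrite mule_ge0// lee_fin.
  - by apply: emeasurable_funM => //; exact: measurable_dev.
  apply: filterS (sum_kernel_ae us) => w Kw _.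
  under eq_bigr do rewrite -EFinM mulrA.
  rewrite sumEFin -mulr_suml -EFinM lee_fin ler_wpM2r ?normc_ge0//.
  by under eq_bigr do rewrite mulrC.
rewrite ge0_integralZl_EFin//; last exact: measurable_dev.
rewrite EFinM lee_wpmul2l ?lee_fin//.
(* At j = 0 there is no drift, and this is the oscillation bound M m(v). *)
have := integral_dev_iter_le o mble nu_fin bL dD bM v 0.
by rewrite /= mulr0 addr0 mulr1.
Qed.

Lemma carleson_bound v :
  (\esum_(x in sector p v) (normc (Kapply nu K b x) * m x)%:E
   <= (2 * M * (fine (CKe p emb nu K) + tail_const r D / (1 - r)) * m v)%:E)%E.
Proof.
apply: ge_ereal_sup => _ [A [finA Av] <-].
rewrite fsbig_finite// sumEFin lee_fin.
set s : seq V := finmap.enum_fset (fset_set A).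
have sv x : x \in s -> vle p x v.
  by rewrite /s in_fset_set// inE => /Av.
have us : uniq s by exact: finmap.fset_uniq.
pose I x := Rintegral nu (S v) (fun w => normc (K x w) * dev v w).
have t0 : 0 <= tail_const r D by exact: tail_const_ge0.
(* The contribution of the sector of [v] is summed by (A2), that of its complement by the decay of
   masses, so the two are kept apart. *)
apply: (@le_trans _ _ (\sum_(x <- s) (2 * (I x * m x) +
    2 * M * tail_const r D / m v `^ a * (m x * m x `^ a)))).
  rewrite big_seq [leRHS]big_seq; apply: ler_sum => x /sv xv.
  apply: le_trans (ler_wpM2r (ltW (m0 x)) (normc_Kapply_le xv)) _.
  by rewrite le_eqVlt; apply/orP; left; apply/eqP; rewrite /I; ring.
rewrite big_split /= -!mulr_sumr.
apply: (@le_trans _ _ (2 * (fine (CKe p emb nu K) * (M * m v)) +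
    2 * M * tail_const r D / m v `^ a * (m v * m v `^ a / (1 - r)))).
  apply: lerD; first by rewrite ler_pM2l//; exact: sum_Rintegral_kernel_le.
  apply: ler_wpM2l; last first.
    exact: (sum_mnu_powR_le levP bdP mble nu_fin q01 mq a0 us sv).
  by rewrite divr_ge0 ?powR_ge0// mulr_ge0// mulr_ge0.
rewrite le_eqVlt; apply/orP; left; apply/eqP; field.
by rewrite !gt_eqF ?powR_gt0 ?subr_gt0.
Qed.

End OperatorBound.

(** * Mean deviation by duality with bounded functions of mean zero *)

Section MeanDeviation.
Context {R : realType} {d : measure_display} {T : measurableType d}
  (mu : {measure set T -> \bar R}) (D : set T) (mD : measurable D) (m : R)
  (m0 : 0 < m) (muD : mu D = m%:E).

Local Notation Int f := (Rintegral mu D f).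

Let integrable1 (k : R) : mu.-integrable D (EFin \o (fun=> k)).
Proof.
have Doo : (mu D < +oo)%E by rewrite muD ltry.
by have [] := cintegrable_cst (Complex k 0) mD Doo.
Qed.

Let Int_cst (k : R) : Int (fun=> k) = k * m.
Proof. by rewrite Rintegral_cst// muD. Qed.

Lemma integrable_le1 (phi : T -> R) : measurable_fun D phi ->
  (forall w, D w -> `|phi w| <= 1) -> mu.-integrable D (EFin \o phi).
Proof.
move=> mphi phi1; apply: le_integrable (integrable1 1) => //.
  exact/measurable_EFinP.
by move=> w Dw /=; rewrite lee_fin normr1 phi1.
Qed.

(* The extremal test function is half the sign of h - c, recentred. *)
Lemma mean_deviation_le (h : T -> R) (C : R) :
  mu.-integrable D (EFin \o h) ->
  (forall phi : T -> R, measurable_fun D phi ->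
    (forall w, D w -> `|phi w| <= 1) -> Int phi = 0 ->
    `|Int (fun w => phi w * h w)| <= C) ->
  Int (fun w => `|h w - m^-1 * Int h|) <= 2 * C.
Proof.
move=> ih test; set c := m^-1 * Int h.
have mh : measurable_fun D h.
  by apply/measurable_EFinP; have /integrableP[] := ih.
have ihc : mu.-integrable D (EFin \o (fun w => h w - c)).
  exact: integrableB ih (integrable1 c).
have Ihc : Int (fun w => h w - c) = 0.
  by rewrite RintegralB// Int_cst /c mulrAC mulVf ?gt_eqF// mul1r subrr.
pose s w : R := if 0 <= h w - c then 1 else - 1.
have s1 w : `|s w| <= 1 by rewrite /s; case: ifP; rewrite ?normrN normr1.
have ms : measurable_fun D s.
  apply: measurable_fun_if => //.
  by apply: measurable_fun_ler => //; exact: measurable_funB.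
have is_ : mu.-integrable D (EFin \o s) by exact: integrable_le1.
pose sigma := m^-1 * Int s.
have sigma1 : `|sigma| <= 1.
  rewrite normrM gtr0_norm ?invr_gt0// ler_pdivrMl// mulr1.
  apply: le_trans (le_normr_Rintegral mD is_) _; rewrite -[leRHS]mul1r -Int_cst.
  by apply: le_Rintegral => //; exact: integrable_norm.
(* Both [s] and its mean [sigma] are bounded by 1, so the factor 1/2 keeps [phi] bounded by 1; it is
   the source of the 2 in the conclusion. *)
pose phi w := 2^-1 * (s w - sigma).
have mphi : measurable_fun D phi.
  by apply: measurable_funM => //; exact: measurable_funB.
have phi1 w : `|phi w| <= 1.
  rewrite normrM gtr0_norm ?invr_gt0// ler_pdivrMl// mulr1.
  by apply: le_trans (ler_normB _ _) _; rewrite -[leRHS]/(1 + 1) lerD.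
have iss : mu.-integrable D (EFin \o (fun w => s w - sigma)).
  exact: integrableB is_ (integrable1 sigma).
have Iphi : Int phi = 0.
  rewrite RintegralZl// RintegralB// Int_cst /sigma mulrAC mulVf ?gt_eqF//.
  by rewrite mul1r subrr mulr0.
have := test phi mphi (fun w _ => phi1 w) Iphi.
have iphi : mu.-integrable D (EFin \o phi) by exact: integrable_le1.
have -> : Int (fun w => phi w * h w) = 2^-1 * Int (fun w => `|h w - c|).
  have iZ k f : mu.-integrable D (EFin \o f) ->
      mu.-integrable D (EFin \o (fun w => k * f w)).
    by move=> ifn; exact: (integrableZl mD k ifn).
  have iabs : mu.-integrable D (EFin \o (fun w => `|h w - c|)).
    exact: (integrable_norm ihc).
  (* Only the first term survives integration, since [phi] and the deviation of [h] from [c] have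
     integral zero. *)
  have -> : (fun w => phi w * h w) = (fun w => 2^-1 * `|h w - c| +
      (c * phi w - 2^-1 * sigma * (h w - c))).
    apply/funext => w.
    have -> : `|h w - c| = s w * (h w - c).
      rewrite /s; case: ifPn => [h0|]; first by rewrite ger0_norm// mul1r.
      by rewrite -ltNge => h0; rewrite ltr0_norm// mulN1r.
    by rewrite /phi; field.
  rewrite RintegralD//; [|exact: iZ|]; last first.
    exact: (integrableB mD (iZ c _ iphi) (iZ (2^-1 * sigma) _ ihc)).
  rewrite RintegralB//; [|exact: iZ|exact: iZ].
  have IZ k f : mu.-integrable D (EFin \o f) ->
      Int (fun w => k * f w) = k * Int f.
    exact: RintegralZl.
  rewrite (IZ _ _ iabs) (IZ c _ iphi) (IZ _ _ ihc) Iphi Ihc.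
  by rewrite !mulr0 subrr addr0.
rewrite normrM gtr0_norm ?invr_gt0// ger0_norm; first by lra.
by apply: Rintegral_ge0 => w _.
Qed.

End MeanDeviation.

(** * Test kernels at one vertex and the converse implication *)

Section TestOperators.
Context {R : realType} {V : choiceType} (p : V -> V) (o : V) (lev : V -> int)
  {d : measure_display} {Bd : measurableType d} (emb : Bd -> nat -> V)
  (nu : {measure set Bd -> \bar R}).
Context (tree : tree_with_end p) (levP : level_fn p o lev)
  (bdP : is_boundary p lev emb)
  (mble : @measurable d Bd = <<s range (bsector p emb) >>)
  (nu_fin : forall x : V, (0 < nu (bsector p emb x) < +oo)%E).
Context (b : Bd -> R[i]) (bL : L1loc p emb nu b).

Local Notation S := (bsector p emb).
Local Notation m := (mnu p emb nu).
Local Notation bv := (bavg p emb nu b).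

Let mS x : measurable (S x). Proof. exact: measurable_bsector. Qed.
Let m0 x : 0 < m x. Proof. exact: mnu_gt0. Qed.
Hint Resolve mS m0 : core.

Section TestKernel.
Context (v : V) (phi : Bd -> R) (mphi : measurable_fun (S v) phi)
  (phi1 : forall w, S v w -> `|phi w| <= 1)
  (phi0 : Rintegral nu (S v) phi = 0).

Let psi : Bd -> R := (fun w => (m v)^-1 * phi w) \_ (S v).

(** The factor 1/m(v) in [psi] is the largest size that (A3) with exponent 1 allows on the sector of
    [v], where the confluent is [v] itself; it also bounds the sum in (A2) by 1. *)
Definition test_kernel (x : V) (w : Bd) : R[i] :=
  if x == v then Complex (psi w) 0 else 0.

Let psi_in w : S v w -> psi w = (m v)^-1 * phi w.
Proof. by move=> wv; rewrite /psi patchE mem_set. Qed.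

Let psi_out w : ~ S v w -> psi w = 0.
Proof. by move=> wv; rewrite /psi patchE memNset. Qed.

Let psi_le w : `|psi w| * m v <= 1.
Proof.
have [wv|wv] := pselect (S v w); last by rewrite psi_out// normr0 mul0r.
rewrite psi_in// normrM gtr0_norm ?invr_gt0// mulrAC mulVf ?gt_eqF// mul1r.
exact: phi1.
Qed.

Let normc_test_kernel x w :
  normc (test_kernel x w) = if x == v then `|psi w| else 0.
Proof.
rewrite /test_kernel; case: ifP => _; last exact: Normc.normc0.
by rewrite /= expr0n addr0 sqrtr_sqr.
Qed.

Let integrable_phi : nu.-integrable (S v) (EFin \o phi).
Proof. exact: (integrable_le1 (mS v) (nu_bsector nu_fin v)). Qed.

Lemma kerA1_test_kernel : kerA1 nu test_kernel.
Proof.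
have i0 : nu.-integrable setT (fun w : Bd => (0 : R)%:E) by exact: integrable0.
have ipsi : nu.-integrable setT (EFin \o psi).
  have := integrableZl (mS v) (m v)^-1 integrable_phi.
  move/(integrable_mkcond _ (mS v)); apply: eq_integrable => // w _.
  by rewrite /psi /= !patchE; case: ifP.
have zero : Rintegral nu setT (fun w : Bd => (0 : R)) = 0.
  by rewrite /Rintegral integral0.
have Ipsi : Rintegral nu setT psi = 0.
  transitivity (Rintegral nu (S v) (fun w => (m v)^-1 * phi w)).
    exact/esym/Rintegral_mkcond.
  by rewrite RintegralZl// phi0 mulr0.
move=> x; rewrite /test_kernel; case: (x == v); split.
- by split.
- by rewrite /cintegral /= zero Ipsi.
- by split.
- by rewrite /cintegral /= zero.
Qed.

Lemma CKe_test_kernel_le1 : (CKe p emb nu test_kernel <= 1)%E.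
Proof.
apply/ess_supP; apply: nearW => w; rewrite /kerSum.
rewrite (_ : esum _ _ =
    \esum_(x in [set v]) (`|psi w| * m x)%:E); last first.
  rewrite [RHS]esum_mkcond; apply: eq_esum => x _.
  rewrite normc_test_kernel; have [->|/eqP xv] := eqVneq x v.
    by rewrite mem_set.
  by rewrite memNset// mul0r.
by rewrite esum_set1 lee_fin ?psi_le// mulr_ge0// ltW.
Qed.

Lemma kerA3_test_kernel : kerA3 p o lev emb nu 1 test_kernel.
Proof.
move=> x w; rewrite normc_test_kernel.
have rhs0 : 0 <= m x `^ 1 / m (conf_vb p o lev emb x w) `^ (1 + 1).
  by rewrite divr_ge0 ?powR_ge0.
case: eqP => [xv|//]; subst x.
have [wv|wv] := pselect (S v w); last by rewrite psi_out// normr0.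
rewrite (conf_vb_in tree levP wv) -[1 + 1]/(2%:R) powR_mulrn ?(ltW (m0 v))//.
rewrite powRr1 ?(ltW (m0 v))//.
rewrite expr2 invfM mulrA mulfV ?gt_eqF// mul1r.
by rewrite -[leRHS]div1r ler_pdivlMr// psi_le.
Qed.

(** Monotonicity of [f] turns C_K <= 1 into the single constant [f 1 1], the same for all [phi] and
    [v]. Of the sum over the sector only the term at [v] is kept. *)
Lemma test_kernel_cond (f : R -> R -> R) :
  (forall c c' a, 0 <= c -> c <= c' -> 0 < a -> f c a <= f c' a) ->
  (forall (K : V -> Bd -> R[i]) (alpha : R),
    0 < alpha -> kerA1 nu K -> kerA2 p emb nu K ->
    kerA3 p o lev emb nu alpha K ->
    (forall x, cintegrable nu setT (fun w => K x w * b w)) /\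
    forall v : V, (\esum_(x in sector p v)
        (normc (Kapply nu K b x) * m x)%:E
      <= (f (fine (CKe p emb nu K)) alpha * m v)%:E)%E) ->
  `|Rintegral nu (S v) (fun w => phi w * complex.Re (b w))| <= f 1 1 * m v /\
  `|Rintegral nu (S v) (fun w => phi w * complex.Im (b w))| <= f 1 1 * m v.
Proof.
move=> fmono fP; have CK1 := CKe_test_kernel_le1.
have CK0 : (0 <= CKe p emb nu test_kernel)%E by exact: CKe_ge0 mble nu_fin _.
have CKoo : kerA2 p emb nu test_kernel by apply: le_lt_trans CK1 (ltry _).
have [_ /(_ v)] := fP _ _ ltr01 kerA1_test_kernel CKoo kerA3_test_kernel.
have fC : f (fine (CKe p emb nu test_kernel)) 1 <= f 1 1.
  apply: fmono => //; first by rewrite fine_ge0.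
  by rewrite -lee_fin fineK// ge0_fin_numE.
move=> le.
have {le} : normc (Kapply nu test_kernel b v) * m v <= f 1 1 * m v.
  apply: le_trans (ler_wpM2r (ltW (m0 v)) fC); rewrite -lee_fin.
  apply: le_trans le; apply: esum_ge; exists [set v].
    by split=> // x ->; exact: vle_refl.
  by rewrite fsbig_set1.
(* The weight m(v) of the vertex cancels the factor 1/m(v) of the kernel. *)
have IntE (g : Bd -> R) : nu.-integrable (S v) (EFin \o g) ->
    Rintegral nu setT (fun w => psi w * g w) * m v =
    Rintegral nu (S v) (fun w => phi w * g w).
  move=> ig.
  have ipg : nu.-integrable (S v) (EFin \o (fun w => phi w * g w)).
    apply: (le_integrable (mS v) _ _ ig) => //.
      apply/measurable_EFinP/measurable_funM => //.
      by apply/measurable_EFinP; have /integrableP[] := ig.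
    by move=> w wv /=; rewrite lee_fin normrM ler_piMl// phi1.
  have -> : Rintegral nu setT (fun w => psi w * g w) =
      Rintegral nu (S v) (fun w => (m v)^-1 * (phi w * g w)).
    rewrite [RHS]Rintegral_mkcond; apply: eq_Rintegral => w _.
    have [wv|wv] := pselect (S v w); rewrite patchE.
      by rewrite mem_set// psi_in// mulrA.
    by rewrite memNset// psi_out// mul0r.
  by rewrite RintegralZl// mulrAC mulVf ?gt_eqF// mul1r.
have [ir ii] := bL v.
have KE : Kapply nu test_kernel b v =
    Complex (Rintegral nu setT (fun w => psi w * complex.Re (b w)))
            (Rintegral nu setT (fun w => psi w * complex.Im (b w))).
  rewrite /Kapply /cintegral /test_kernel eqxx.
  congr Complex; apply: eq_Rintegral => w _.
    by rewrite cReM /= mul0r subr0.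
  by rewrite cImM /= mul0r addr0.
move=> le; split.
  rewrite -IntE// normrM [X in _ * X]gtr0_norm//; apply: le_trans le.
  by rewrite ler_wpM2r ?(ltW (m0 v))// KE; exact: (ler_Re_normc (Complex _ _)).
rewrite -IntE// normrM [X in _ * X]gtr0_norm//; apply: le_trans le.
by rewrite ler_wpM2r ?(ltW (m0 v))// KE; exact: (ler_Im_normc (Complex _ _)).
Qed.

End TestKernel.

(** The test functions are real, so the real and imaginary parts of b are tested separately; each
    has mean deviation at most 2 f(1, 1), whence the 4. *)
Lemma BMO_of_cond_ii : cond_ii p o lev emb nu b -> BMO p emb nu b.
Proof.
move=> [f [_ fmono fP]]; split=> //; exists (4 * f 1 1) => v.
have [ir ii] := bL v.
have test phi mphi phi1 phi0 :=
  @test_kernel_cond v phi mphi phi1 phi0 f fmono fP.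
have devR := mean_deviation_le (mS v) (m0 v) (nu_bsector nu_fin v) ir
  (fun phi mphi phi1 phi0 => (test phi mphi phi1 phi0).1).
have devI := mean_deviation_le (mS v) (m0 v) (nu_bsector nu_fin v) ii
  (fun phi mphi phi1 phi0 => (test phi mphi phi1 phi0).2).
rewrite ler_pdivrMl//.
have iB := cintegrable_sub_cst mble nu_fin bL v (bv v).
have [irB iiB] := iB.
have ReB w : complex.Re (b w - bv v) = complex.Re (b w) -
    (m v)^-1 * Rintegral nu (S v) (fun w => complex.Re (b w)).
  by rewrite /bavg cReB cReM /= mul0r subr0.
have ImB w : complex.Im (b w - bv v) = complex.Im (b w) -
    (m v)^-1 * Rintegral nu (S v) (fun w => complex.Im (b w)).
  by rewrite /bavg cImB cImM /= mul0r addr0.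
have inR := integrable_norm irB.
have inI := integrable_norm iiB.
apply: (@le_trans _ _ (Rintegral nu (S v)
   (fun w => `|complex.Re (b w - bv v)| + `|complex.Im (b w - bv v)|))).
  apply: le_Rintegral => //.
  - exact: cintegrable_normc.
  - exact: (integrableD (mS v) inR inI).
  - by move=> w _; exact: normc_ler_ReIm.
rewrite RintegralD//.
under eq_Rintegral do rewrite ReB.
under [X in _ + X]eq_Rintegral do rewrite ImB.
lra.
Qed.

End TestOperators.

Theorem theorem3p2 (R : realType) (V : choiceType) (p : V -> V) (o : V)
  (lev : V -> int) (d : measure_display) (Bd : measurableType d)
  (emb : Bd -> nat -> V) (nu : {measure set Bd -> \bar R}) (b : Bd -> R[i]) :
  tree_with_end p ->
  level_fn p o lev ->
  is_boundary p lev emb ->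
  @measurable d Bd = <<s range (bsector p emb) >> ->
  at_least_two_succs p ->
  (forall x : V, (0 < nu (bsector p emb x) < +oo)%E) ->
  doubling p o lev emb nu ->
  L1loc p emb nu b ->
  (BMO p emb nu b <-> cond_ii p o lev emb nu b).
Proof.
move=> tree levP bdP mble succ2 nu_fin dbl bL; split; last first.
  exact: BMO_of_cond_ii.
move=> [_ [M bM]].
have [D dD] := doubling_succ tree levP bdP nu_fin dbl.
have [q q01 mq] := mnu_decay levP bdP mble succ2 nu_fin dD.
have M0 := bmo_ge0 o nu_fin bM.
have D0 := doubling_ge0 o nu_fin dD.
have M20 : 0 <= 2 * M by exact: mulr_ge0.
(* The constant of [carleson_bound]: M depends on b, D and q on the measure, and none of them on the
   kernel. It is affine in [c] with slope 2 M >= 0, hence nondecreasing. *)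
exists (fun c a => 2 * M * (c + tail_const (q `^ a) D / (1 - q `^ a))); split.
- move=> c a c0 a0; have r1 := powR_lt1 q01 a0.
  rewrite mulr_ge0// addr_ge0// divr_ge0 ?subr_ge0 ?(ltW r1)//.
  exact: tail_const_ge0 (powR_ge0 _ _) r1 _ D0.
- by move=> c c' a _ cc' _; rewrite ler_wpM2l// lerD2r.
move=> K a a0 KA1 KA2 KA3; split=> [x|v].
  exact: (cintegrable_kernel tree levP mble nu_fin bL dD bM q01 mq a0 KA1 KA3).
exact: (carleson_bound tree levP bdP mble nu_fin bL dD bM q01 mq a0 KA1 KA2 KA3).
Qed.
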